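(* For every integer $k \geq 1$, the class $\mathcal{T}_k$ of all graphs of tree-width at most $k$ is homomorphism-distinguishing closed. That is, for every graph $F \notin \mathcal{T}_k$ (i.e. every graph $F$ of tree-width greater than $k$) there exist graphs $G$ and $H$ such that $\hom(F',G) = \hom(F',H)$ for all $F' \in \mathcal{T}_k$, but $\hom(F,G) \neq \hom(F,H)$.
   Context: All graphs are finite, simple and undirected. For graphs $F$ and $G$, a homomorphism from $F$ to $G$ is a map $\varphi\colon V(F)\to V(G)$ with $\varphi(v)\varphi(w)\in E(G)$ for all $vw\in E(F)$; $\hom(F,G)$ denotes the number of homomorphisms from $F$ to $G$. For a class of graphs $\mathcal{F}$, two graphs $G,H$ are $\mathcal{F}$-equivalent if $\hom(F,G)=\hom(F,H)$ for all $F\in\mathcal{F}$. A class $\mathcal{F}$ is called homomorphism-distinguishing closed if for every graph $F\notin\mathcal{F}$ there are graphs $G,H$ that are $\mathcal{F}$-equivalent but satisfy $\hom(F,G)\neq\hom(F,H)$. *)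

(* Defs.v *)
From mathcomp Require Import all_boot boolp.
Set Implicit Arguments.
Unset Strict Implicit.
Unset Printing Implicit Defensive.

Record sgraph := SGraph {
  vertex :> finType;
  edge : rel vertex;
  edge_sym : symmetric edge;
  edge_irrefl : irreflexive edge }.

Definition is_hom (F G : sgraph) (f : F -> G) : bool :=
  [forall v, forall w, edge v w ==> edge (f v) (f w)].

Definition hom (F G : sgraph) : nat := #|[set f : {ffun F -> G} | is_hom f]|.

Definition graph_class := sgraph -> Prop.

Definition equivalent (C : graph_class) (G H : sgraph) : Prop :=
  forall F : sgraph, C F -> hom F G = hom F H.

Definition hom_distinguishing_closed (C : graph_class) : Prop :=
  forall F : sgraph, ~ C F ->
    exists G H : sgraph, equivalent C G H /\ hom F G <> hom F H.

Definition connected_in (G : sgraph) (S : {set G}) : Prop :=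
  {in S &, forall s t,
     connect [rel x y | [&& x \in S, y \in S & edge x y]] s t}.

(* A duplicate-free closed walk of length at most 2 is not a graph cycle. *)
Definition acyclic (G : sgraph) : Prop :=
  forall c : seq G, 2 < size c -> ~ ucycle (@edge G) c.

Definition is_tree (T : sgraph) : Prop :=
  [/\ 0 < #|T|, connected_in [set: T] & acyclic T].

Record tree_decomposition (G : sgraph) := TreeDecomposition {
  td_tree : sgraph;
  td_bag : td_tree -> {set G};
  td_is_tree : is_tree td_tree;
  td_vertex : forall v : G, exists t, v \in td_bag t;
  td_edge : forall v w : G, edge v w ->
    exists t, (v \in td_bag t) && (w \in td_bag t);
  td_connected : forall v : G, connected_in [set t | v \in td_bag t] }.

(* The predecessor is truncated: the graph without vertices gets tree-width 0
   instead of -1, so the predicates "tree-width at most k", k : nat, agree. *)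
Definition width (G : sgraph) (D : tree_decomposition G) : nat :=
  (\max_(t : td_tree D) #|td_bag t|).-1.

Lemma trivial_tree_decomposition (G : sgraph) : tree_decomposition G.
Proof.
pose T := @SGraph unit (fun _ _ => false) (fun _ _ => erefl) (fun _ => erefl).
apply: (@TreeDecomposition G T (fun=> [set: G])).
- split; first by rewrite card_unit.
  + by move=> [] [] _ _; apply: connect0.
  + by case=> [|x [|y [|z c]]].
- by move=> v; exists tt; rewrite inE.
- by move=> v w _; exists tt; rewrite !inE.
- by move=> v [] [] _ _; apply: connect0.
Qed.

Lemma width_exists (G : sgraph) :
  exists n, `[< exists D : tree_decomposition G, width D = n >].
Proof.
by exists (width (trivial_tree_decomposition G)); apply/asboolP; eexists.
Qed.

Definition treewidth (G : sgraph) : nat := ex_minn (width_exists G).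

Lemma treewidth_leP (G : sgraph) (k : nat) :
  treewidth G <= k <-> exists D : tree_decomposition G, width D <= k.
Proof.
rewrite /treewidth; case: ex_minnP => m /asboolP[D Dm] m_min.
split=> [mk|[E Ek]]; first by exists D; rewrite Dm.
by apply: leq_trans Ek; apply: m_min; apply/asboolP; exists E.
Qed.

Definition treewidth_at_most (k : nat) : graph_class :=
  fun G => treewidth G <= k.

(* Main.v *)
(* Let F have tree-width more than k, and let X_0(F), X_1(F) be the untwisted
   and the twisted CFI graph of F, twisted at one vertex u. A homomorphism
   phi : F' -> F lifts to these graphs in equally many ways, or else it has no
   lift to X_1(F) at all. The identity of F lifts to X_0(F) only, by the
   handshake lemma, so hom(F, X_1(F)) < hom(F, X_0(F)). By the tree-width duality
   theorem F has a haven of order k + 2. If F' has tree-width at most k, the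
   robber's positions against cops on the images of the bags, joined to u by
   paths along which the robber may move, provide a lift to X_1(F) of every phi.

   Duality follows Mazoit: take an inclusion-minimal upward closed family of
   connected sets for which every decomposition into bags of size at most k + 1,
   each enlarged by a part private to it, has a private part containing a member
   of the family. If two members did not touch, decompositions avoiding the rest
   of the family could be glued along a minimum separator between them. *)
Require Import Defs.
From mathcomp Require Import all_boot boolp.
Set Implicit Arguments.
Unset Strict Implicit.
Unset Printing Implicit Defensive.

(** * Separations and Menger's theorem *)

Section Connectivity.
Variable T : finType.
Implicit Types (e : rel T) (A B L R M S : {set T}) (x y z : T).

Definition inside e S : rel T := [rel x y | [&& x \in S, y \in S & e x y]].

Definition conn e S : Prop := {in S &, forall x y, connect (inside e S) x y}.

Lemma inside_sym e S : symmetric e -> symmetric (inside e S).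
Proof. by move=> es x y; rewrite /inside /= es andbCA. Qed.

Lemma connect_insideS e e' A B x y : subrel e e' -> A \subset B ->
  connect (inside e A) x y -> connect (inside e' B) x y.
Proof.
move=> ee' /subsetP AB; apply: connect_sub => a b /and3P[aA bA eab].
by apply: connect1; rewrite /inside /= !AB ?ee'.
Qed.

Lemma conn_subrel e e' S : subrel e e' -> conn e S -> conn e' S.
Proof. by move=> ee' cS x y xS yS; apply: connect_insideS (cS x y xS yS). Qed.

Lemma conn1 e x : conn e [set x].
Proof. by move=> y z /set1P-> /set1P->; apply: connect0. Qed.

Lemma conn_center e S q : symmetric e ->
  {in S, forall z, connect (inside e S) z q} -> conn e S.
Proof.
move=> es cq x y xS yS; apply: connect_trans (cq x xS) _.
by rewrite (sym_connect_sym (inside_sym S es)) cq.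
Qed.

Lemma connU e A B a b : symmetric e -> conn e A -> conn e B ->
  a \in A -> b \in B -> (a == b) || e a b -> conn e (A :|: B).
Proof.
move=> es cA cB aA bB ab; apply: (conn_center (q := b)) => // z.
have zb : {in B, forall w, connect (inside e (A :|: B)) w b}.
  by move=> w wB; apply: connect_insideS (subsetUr _ _) (cB w b wB bB).
case/setUP=> [zA|/zb//]; apply: (@connect_trans _ _ a).
  exact: connect_insideS (subsetUl _ _) (cA z a zA aA).
case/orP: ab => [/eqP->|eab]; first exact: connect0.
by apply: connect1; rewrite /inside /= !inE aA bB eab orbT.
Qed.

Lemma connect_stable e (P : pred T) x y :
  (forall a b, P a -> e a b -> P b) -> connect e x y -> P x -> P y.
Proof.
move=> clP /connectP[p + ->]; elim: p x => //= z p IHp x /andP[exz zp] Px.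
exact: IHp zp (clP _ _ Px exz).
Qed.

Lemma conn_stable e S (P : pred T) x : conn e S -> x \in S -> P x ->
  {in S &, forall a b, P a -> e a b -> P b} -> {in S, forall y, P y}.
Proof.
move=> cS xS Px clP y yS; apply: connect_stable (cS x y xS yS) Px => a b Pa.
by case/and3P=> aS bS; apply: clP.
Qed.

Definition separation e L R :=
  L :|: R = [set: T] /\ forall x y, x \notin R -> y \notin L -> ~~ e x y.

Lemma separationC e L R : symmetric e -> separation e L R -> separation e R L.
Proof.
move=> es [LR sLR]; split; first by rewrite setUC.
by move=> x y xL yR; rewrite es sLR.
Qed.

Lemma separation_or e L R x : separation e L R -> (x \in L) || (x \in R).
Proof. by case=> LR _; rewrite -in_setU LR inE. Qed.

(** A walk inside [M] can leave [L] only through [L :&: R], which [M] meets at most in [q]. So a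
    walk from [M :&: L] to [q] reaches [q] before leaving [L]. *)
Lemma conn_trim e L R M q : symmetric e -> separation e L R -> conn e M ->
  q \in M -> q \in L -> M :&: (L :&: R) \subset [set q] -> conn e (M :&: L).
Proof.
move=> es [_ sLR] cM qM qL /subsetP Mq; apply: (conn_center (q := q)) => // z.
case/setIP=> zM zL; have /connectP[p zp qE] := cM z q zM qM.
elim: p z zM zL zp qE => [z _ _ _ ->|w p IHp z zM zL] /=; first exact: connect0.
case/andP=> /and3P[_ wM ezw] wp qE.
have [zR|zR] := boolP (z \in R).
  have /set1P-> : z \in [set q] by apply: Mq; rewrite !inE zM zL.
  exact: connect0.
have wL : w \in L by apply: contraLR ezw; apply: sLR.
apply: connect_trans (IHp w wM wL wp qE); apply: connect1.
by rewrite /inside /= !inE zM zL wM wL ezw.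
Qed.

(** Disjoint connected sets stand in for the disjoint paths of Menger's theorem: they can be trimmed
    and united without rerouting walks. An index need not lie in its set. *)
Definition linked e A B k := exists (I : {set T}) (M : T -> {set T}),
  [/\ k <= #|I|,
      {in I, forall i, [/\ conn e (M i), ~~ [disjoint M i & A]
                        & ~~ [disjoint M i & B]]}
    & {in I &, forall i j x, x \in M i -> x \in M j -> i = j}].

(** Disjoint sets pick distinct points of [B]; there are at least [k = #|B|] of them, so the points
    exhaust [B] and can serve as indices. *)
Lemma linked_onto e A B k : linked e A B k -> #|B| = k ->
  exists M : T -> {set T},
    {in B, forall b, [/\ b \in M b, conn e (M b) & ~~ [disjoint M b & A]]}
    /\ {in B &, forall b c x, x \in M b -> x \in M c -> b = c}.
Proof.
move=> [I [M [kI MP Mdis]]] Bk.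
pose g i := odflt i [pick b in M i | b \in B].
have gP i : i \in I -> (g i \in M i) /\ (g i \in B).
  move=> /MP[_ _ /pred0Pn[b /andP[bM bB]]]; rewrite /g.
  by case: pickP => [c /andP[]//|/(_ b)]; rewrite [b \in M i]bM [b \in B]bB.
have g_inj : {in I &, injective g}.
  move=> i j iI jI gij; apply: (Mdis i j iI jI (g i)); first by case: (gP i iI).
  by rewrite gij; case: (gP j jI).
have gI : g @: I = B.
  apply/eqP; rewrite eqEcard card_in_imset // Bk kI andbT.
  by apply/subsetP=> _ /imsetP[i iI ->]; case: (gP i iI).
pose h b := odflt b [pick i in I | g i == b].
have hP b : b \in B -> (h b \in I) /\ (g (h b) = b).
  rewrite -{1}gI => /imsetP[i iI ->]; rewrite /h.
  by case: pickP => [j /andP[jI /eqP]//|/(_ i)]; rewrite /= iI eqxx.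
exists (M \o h); split=> [b|b c] bB.
  have [hI ghb] := hP b bB; have [cM MA _] := MP _ hI; split=> //=.
  by have [] := gP _ hI; rewrite ghb.
move=> cB x /= xb xc; have [hb gb] := hP b bB; have [hc gc] := hP c cB.
by rewrite -gb -gc (Mdis _ _ hb hc x xb xc).
Qed.

(** By disjointness the only point of [Z] in [M i] is [i], so [M i] meets the separator at most in
    [i] and [conn_trim] applies. *)
Lemma conn_trim_family e L R A (Z : {set T}) (M : T -> {set T}) :
  symmetric e -> separation e L R -> A \subset L -> L :&: R \subset Z -> Z \subset L ->
  {in Z, forall b, [/\ b \in M b, conn e (M b) & ~~ [disjoint M b & A]]} ->
  {in Z &, forall b c x, x \in M b -> x \in M c -> b = c} ->
  {in Z, forall i, [/\ conn e (M i :&: L), i \in M i :&: L,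
    ~~ [disjoint M i :&: L & A] & {in M i :&: L, forall z, z \in R -> z = i}]}.
Proof.
move=> es sep AL SZ ZL MP Mdis i iZ; have [iM cM /pred0Pn[a /andP[/= aM aA]]] := MP i iZ.
have iL := subsetP ZL i iZ.
have eqi z : z \in M i :&: L -> z \in R -> z = i.
  case/setIP=> zM zL zR; have zZ : z \in Z by apply: (subsetP SZ); rewrite inE zL.
  by have [zMz _ _] := MP z zZ; apply: (Mdis z i zZ iZ z).
split=> //; last by apply/pred0Pn; exists a; rewrite /= inE aM aA (subsetP AL).
  apply: (conn_trim es sep cM iM iL).
  by apply/subsetP=> z /setIP[zM /setIP[zL zR]]; rewrite inE (eqi z) // inE zM.
by rewrite inE iM.
Qed.

Definition del_edge e x y : rel T :=
  [rel u v | e u v && ((u, v) \notin [:: (x, y); (y, x)])].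

Lemma del_edge_sym e x y : symmetric e -> symmetric (del_edge e x y).
Proof.
move=> es u v; rewrite /del_edge /= es !inE !xpair_eqE orbC.
by rewrite [(u == x) && _]andbC [(u == y) && _]andbC.
Qed.

Lemma del_edge_sub e x y : subrel (del_edge e x y) e.
Proof. by move=> u v /andP[]. Qed.

(** Both ends of the deleted edge lie in [R' :|: R], so putting it back creates no crossing edge. *)
Lemma separation_del_edge e x y L R L' R' : symmetric e ->
  x \notin R -> y \notin L -> separation (del_edge e x y) L R ->
  separation (del_edge e x y) L' R' -> x \in R' ->
  separation e (L' :&: L) (R' :|: R).
Proof.
move=> es xR yL [LR sLR] sep' xR'; have [_ sLR'] := sep'; split.
  apply/setP=> z; rewrite !inE; have:= separation_or z sep'.
  have:= separation_or z (conj LR sLR).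
  by case: (z \in L); case: (z \in R); case: (z \in L'); case: (z \in R').
move=> u v; rewrite !inE negb_or negb_and => /andP[uR' uR] vL.
apply: contraL vL => euv; rewrite negb_or !negbK.
have d: del_edge e x y u v.
  rewrite /del_edge /= euv !inE negb_or !xpair_eqE !negb_and.
  have -> : u != x by apply: contraNneq uR' => ->.
  by have -> : u != y by apply: contraNneq uR => ->;
     have:= separation_or y (conj LR sLR); rewrite (negPf yL).
apply/andP; split; [have:= sLR' u v uR'|have:= sLR u v uR]; rewrite d.
  by case: (v \in L') => // /(_ isT).
by case: (v \in L) => // /(_ isT).
Qed.

(* Göring's induction: if deleting the edge xy creates a separation (L, R) with
   |L ∩ R| < k, then the families given by induction for A and (L ∩ R) ∪ {x},
   and for (L ∩ R) ∪ {y} and B, are joined along L ∩ R and along the edge xy. *)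
Lemma menger e A B k : symmetric e ->
  (forall L R, separation e L R -> A \subset L -> B \subset R -> k <= #|L :&: R|) ->
  linked e A B k.
Proof.
have [n] := ubnP #|[set p | e p.1 p.2]|; elim: n e A B => // n IHn e A B en es minS.
(* Without edges, [A] and [~: A :|: B] form a separation meeting in [A :&: B], whose singletons link
   [A] to [B]. *)
have [[[x0 y0] /= e0]|noe] := pselect (exists p, e p.1 p.2); last first.
  have kAB : k <= #|A :&: B|.
    have := minS A (~: A :|: B); rewrite setIUr setICr set0U; apply => //.
    - split; first by rewrite setUA setUCr setTU.
      by move=> x y _ _; apply/negP => exy; apply: noe; exists (x, y).
    - exact: subsetUr.
  exists (A :&: B), (fun x => [set x]); split=> //.
    move=> i /setIP[iA iB]; split; first exact: conn1.
    + by apply/pred0Pn; exists i; rewrite /= inE eqxx.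
    + by apply/pred0Pn; exists i; rewrite /= inE eqxx.
  by move=> i j _ _ x /set1P-> /set1P.
(* If no deletion creates a separation of order below [k] across the deleted edge, the hypothesis
   survives the deletion of the edge from [x0] to [y0], and induction applies directly. *)
have [[x [y [L [R [exy xR yL [sep' AL BR ltk]]]]]]|nosep] := pselect (exists x y L R,
    [/\ e x y, x \notin R, y \notin L &
    [/\ separation (del_edge e x y) L R, A \subset L, B \subset R & #|L :&: R| < k]]); last first.
  set e' := del_edge e x0 y0.
  have e's : symmetric e' := del_edge_sym _ _ es.
  have : linked e' A B k.
    apply: IHn => //.
      apply: leq_trans (_ : _ < #|[set p | e p.1 p.2]|) _; last by rewrite -ltnS.
      apply: proper_card; apply/properP; split.
        by apply/subsetP=> p; rewrite !inE; apply: del_edge_sub.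
      by exists (x0, y0); rewrite !inE //= /e' /del_edge /= !inE eqxx andbF.
    move=> L R sepLR AL BR; rewrite leqNgt; apply/negP=> ltk.
    have [sepe|nsepe] := pselect (separation e L R).
      by have := minS L R sepe AL BR; rewrite leqNgt ltk.
    apply: nsepe; split; first by case: sepLR.
    move=> u v uR vL; apply/negP=> euv; have [_ /(_ u v uR vL)] := sepLR.
    rewrite /e' /del_edge /= euv negbK !inE !xpair_eqE => /orP uv.
    apply: nosep; exists u, v, L, R; split=> //; split=> //.
    case: uv => /andP[/eqP ux /eqP vy]; first by rewrite ux vy.
    have <- : e' = del_edge e u v; last by [].
    by rewrite ux vy; apply/funext=> a; apply/funext=> b; rewrite /e' /del_edge /= !inE orbC.
  case=> I [M [kI MP Mdis]]; exists I, M; split=> // i /MP[cM MA MB]; split=> //.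
  exact: conn_subrel (@del_edge_sub _ _ _) cM.
set e' := del_edge e x y in sep'.
have e's : symmetric e' := del_edge_sym _ _ es.
have sub' : subrel e' e := @del_edge_sub _ _ _.
have en' : #|[set p | e' p.1 p.2]| < n.
  apply: leq_trans (_ : _ < #|[set p | e p.1 p.2]|) _; last by rewrite -ltnS.
  apply: proper_card; apply/properP; split.
    by apply/subsetP=> p; rewrite !inE; apply: sub'.
  by exists (x, y); rewrite !inE //= /e' /del_edge /= !inE eqxx andbF.
have xL : x \in L by have:= separation_or x sep'; rewrite (negPf xR) orbF.
have yR : y \in R by have:= separation_or y sep'; rewrite (negPf yL).
pose S := L :&: R; rewrite -/S in ltk.
have xS : x \notin S by rewrite inE (negPf xR) andbF.
have yS : y \notin S by rewrite inE (negPf yL).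
(* Adding [x] to [R] gives a separation of [e], so the order of [(L, R)] is only one below [k]. *)
have kS : #|S|.+1 = k.
  apply/eqP; rewrite eqn_leq ltk /=.
  have := minS (setT :&: L) ([set x] :|: R).
  rewrite setTI setIUr; have -> : L :&: [set x] = [set x].
    by apply/setIidPr; rewrite sub1set.
  rewrite cardsU1 xS; apply=> //; last exact: subset_trans BR (subsetUr _ _).
  have := @separation_del_edge e x y L R setT [set x] es xR yL sep'.
  rewrite setTI; apply; last by rewrite inE.
  by split; [rewrite setTU|move=> ? ? _; rewrite inE].
have Sx : #|x |: S| = k by rewrite cardsU1 xS.
have Sy : #|y |: S| = k by rewrite cardsU1 yS.
(* A separation of [e'] between [A] and [x |: S] combines with [(L, R)] into one of [e] between [A]
   and [B], of no larger order. *)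
have [|M [MP Mdis]] := linked_onto (IHn e' A (x |: S) en' e's _) Sx.
  move=> L1 R1 sep1 AL1; rewrite subUset sub1set => /andP[xR1 SR1].
  have := separation_del_edge es xR yL sep' sep1 xR1 => sepe.
  apply: leq_trans (minS _ _ sepe _ _) _.
  - by rewrite subsetI AL1.
  - exact: subset_trans BR (subsetUr _ _).
  - apply: subset_leq_card; apply/subsetP=> z; rewrite !inE => /andP[/andP[zL1 zL]].
    by rewrite zL1 => /orP[//|zR]; apply: (subsetP SR1); rewrite inE zL.
have [|N [NP Ndis]] := linked_onto (IHn e' B (y |: S) en' e's _) Sy.
  move=> L1 R1 sep1 BL1; rewrite subUset sub1set => /andP[yR1 SR1].
  have eyx : del_edge e y x = e'.
    by apply/funext=> a; apply/funext=> b; rewrite /e' /del_edge /= !inE orbC.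
  have sepe : separation e (L1 :&: R) (R1 :|: L).
    by apply: (separation_del_edge (x := y) (y := x)) => //; rewrite eyx //;
       apply: separationC.
  apply: leq_trans (minS _ _ (separationC es sepe) _ _) _.
  - exact: subset_trans AL (subsetUr _ _).
  - by rewrite subsetI BL1.
  - apply: subset_leq_card; apply/subsetP=> z; rewrite !inE => /andP[zRL /andP[zL1 zR]].
    by rewrite zL1; case/orP: zRL => // zL; apply: (subsetP SR1); rewrite inE zL.
have SxL : x |: S \subset L by rewrite subUset sub1set xL subsetIl.
have SyR : y |: S \subset R by rewrite subUset sub1set yR subsetIr.
have SyC : R :&: L \subset y |: S by rewrite setIC subsetUr.
have trimM := conn_trim_family e's sep' AL (subsetUr _ _) SxL MP Mdis.
have trimN := conn_trim_family e's (separationC e's sep') BR SyC SyR NP Ndis.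
(* The set ending in [x] is continued from [y] across the edge, every other one from its own end in
   [S]. *)
pose h i := if i == x then y else i.
have hS i : i \in x |: S -> h i \in y |: S.
  by rewrite /h; case: eqP => [_ _|nx /setU1P[/nx//|iS]]; rewrite !inE ?eqxx // -in_setI iS orbT.
have hinj : {in x |: S &, injective h}.
  move=> i j; rewrite /h; case: eqP => [->|ix] iS; case: eqP => [->|jx] jS //.
    by move=> yj; move: jS; rewrite -yj in_setU1 (negPf yS) orbF => /eqP yx; case: jx; rewrite -yj.
  by move=> yj; move: iS; rewrite yj in_setU1 (negPf yS) orbF => /eqP yx; case: ix; rewrite yj.
exists (x |: S), (fun i => (M i :&: L) :|: (N (h i) :&: R)); split.
- by rewrite Sx.
- move=> i iS; have [cM iM MA Mi] := trimM i iS.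
  have [cN hN NB Ni] := trimN _ (hS i iS); split.
  + apply: (connU (a := i) (b := h i)) => //; try exact: conn_subrel sub' _.
    by rewrite /h; case: (eqVneq i x) => [->|_]; rewrite ?eqxx // exy orbT.
  + case/pred0Pn: MA => a /andP[aM aA]; apply/pred0Pn; exists a; apply/andP; split=> //.
    by apply/setUP; left.
  + case/pred0Pn: NB => a /andP[aM aA]; apply/pred0Pn; exists a; apply/andP; split=> //.
    by apply/setUP; right.
(* A common vertex lies in [L :&: R], hence is the end of both trimmed sets. *)
have MN i j z : i \in x |: S -> j \in x |: S -> z \in M i :&: L -> z \in N (h j) :&: R -> i = j.
  move=> iS jS zM zN; have [_ _ _ Mi] := trimM i iS; have [_ _ _ Nj] := trimN _ (hS j jS).
  have zL : z \in L by case/setIP: zM.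
  have zR : z \in R by case/setIP: zN.
  have zi := Mi z zM zR; have zj := Nj z zN zL.
  rewrite zi in zR zL zj; have ix : i != x by apply: contraNneq xR => <-.
  by move: zj; rewrite /h; case: eqP => // _ iy; rewrite -iy zL in yL.
move=> i j iS jS z /setUP[zi|zi] /setUP[zj|zj].
- by case/setIP: zi => zi _; case/setIP: zj => zj _; apply: Mdis zi zj.
- exact: MN zi zj.
- by apply/esym; apply: MN zj zi.
- case/setIP: zi => zi _; case/setIP: zj => zj _.
  by apply: hinj => //; apply: Ndis zi zj; apply: hS.
Qed.

End Connectivity.

(** * Trees and tree decompositions *)

Lemma connect_homo (T T' : finType) (e : rel T) (e' : rel T') (f : T -> T') x y :
  (forall a b, e a b -> e' (f a) (f b)) -> connect e x y -> connect e' (f x) (f y).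
Proof.
move=> ef exy; pose P z := connect e' (f x) (f z).
suff clP a b : P a -> e a b -> P b by apply: (connect_stable clP exy (connect0 _ _)).
move=> xa eab.
exact: connect_trans xa (connect1 (ef _ _ eab)).
Qed.

(** Connectedness gives an edge leaving a proper subset [S]. A second neighbour in [S] of its outer
    end [t] would close a cycle through [t] and a path inside [S]. *)
Lemma tree_ind (T : sgraph) (t0 : T) (P : {set T} -> Prop) :
  is_tree T -> P [set t0] ->
  (forall S s t, P S -> t0 \in S -> s \in S -> t \notin S -> edge s t ->
     {in S, forall s', edge s' t -> s' = s} -> P (t |: S)) ->
  P [set: T].
Proof.
move=> [_ cT aT] P0 PS; have es := @edge_sym T.
suff /(_ #|T|.-1) : forall n, n < #|T| ->
    exists S : {set T}, [/\ #|S| = n.+1, t0 \in S, conn (@edge T) S & P S].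
  have T_gt0 : 0 < #|T| by apply/card_gt0P; exists t0.
  rewrite ltn_predL T_gt0 => /(_ isT)[S [ST _ _]].
  suff -> : S = [set: T] by [].
  by apply/eqP; rewrite eqEcard subsetT cardsT ST (prednK T_gt0) leqnn.
elim=> [_|n IHn nT].
  by exists [set t0]; rewrite cards1 inE; split=> //; apply: conn1.
have [S [Sn t0S cS PSS]] := IHn (ltnW nT).
have [s [t [sS tS st]]] : exists s t, [/\ s \in S, t \notin S & edge s t].
  apply: contrapT => noex.
  have /setIidPl : [set: T] \subset S.
    apply/subsetP=> z _.
    have := @conn_stable _ _ _ (mem S) t0 cT (in_setT t0) t0S.
    apply; rewrite ?inE // => a b _ _ aS eab; apply: contrapT => /negP bS.
    by apply: noex; exists a, b.
  by rewrite setTI => ST; move: nT; rewrite -Sn ST cardsT ltnn.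
have uniq_nb : {in S, forall s', edge s' t -> s' = s}.
  move=> s' s'S s't; apply: contrapT => ss'.
  have /connectP[p0 sp0 lastp0] := cS s s' sS s'S; move: lastp0.
  case/shortenP: sp0 => p sp up _ s'E; have pS : all (mem S) (s :: p).
    rewrite /= sS /=; elim: p s {s'E up ss' st} sS sp => //= a p IHp s sS.
    by case/andP=> /and3P[_ aS _] /IHp->; rewrite ?aS.
  apply: (aT (t :: s :: p)).
    by case: p s'E {pS sp up} => //= s'E.
  rewrite /ucycle cons_uniq up andbT; apply/andP; split; last first.
    by apply: contra tS => tsp; apply: (allP pS).
  rewrite (cycle_path t) /= -s'E s't es st /=.
  by apply: sub_path sp => a b /and3P[].
exists (t |: S); split.
- by rewrite cardsU1 tS Sn.
- by rewrite !inE t0S orbT.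
- rewrite setUC; apply: (connU (a := s) (b := t)) => //; first exact: conn1.
    by rewrite inE.
  by rewrite st orbT.
- exact: PS st uniq_nb.
Qed.

(** The rank is the order in which [tree_ind] adds the vertices. Together with [rank_acyclic] it
    spares the gluing of trees any reasoning about cycles. *)
Lemma tree_rank (T : sgraph) (t0 : T) : is_tree T -> exists r : T -> nat,
  [/\ injective r, forall t, r t < #|T|, r t0 = 0
    & forall t q q', edge t q -> edge t q' -> r q < r t -> r q' < r t -> q = q'].
Proof.
move=> treeT; suff [r [r_inj rT r0 rP]] : exists r : T -> nat,
  [/\ {in [set: T] &, injective r}, {in [set: T], forall t, r t < #|[set: T]|}, r t0 = 0
    & {in [set: T] & &, forall t q q', edge t q -> edge t q' ->
        r q < r t -> r q' < r t -> q = q'}].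
  exists r; split=> //; first by move=> a b; apply: r_inj; rewrite inE.
    by move=> t; rewrite -cardsT; apply: rT; rewrite inE.
  by move=> t q q'; apply: rP; rewrite inE.
apply: (tree_ind (t0 := t0) (P := fun S => exists r : T -> nat,
  [/\ {in S &, injective r}, {in S, forall t, r t < #|S|}, r t0 = 0
    & {in S & &, forall t q q', edge t q -> edge t q' ->
        r q < r t -> r q' < r t -> q = q'}])) => //.
  exists (fun=> 0); split=> //.
    by move=> a b /set1P-> /set1P->.
  by move=> a _; rewrite cards1.
move=> S s t [r [r_inj rS r0 rP]] t0S sS tS st suniq.
pose r' z := if z == t then #|S| else r z.
have r't : r' t = #|S| by rewrite /r' eqxx.
have r'S : {in S, forall z, r' z = r z}.
  by move=> z zS; rewrite /r'; case: eqP => // zt; rewrite zt (negPf tS) in zS.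
exists r'; split.
- move=> a b /setU1P[->|aS] /setU1P[->|bS] //; rewrite ?r't ?r'S //.
  + by move=> E; have:= rS b bS; rewrite E ltnn.
  + by move=> E; have:= rS a aS; rewrite E ltnn.
  + exact: r_inj.
- move=> a /setU1P[->|aS]; rewrite cardsU1 tS ?r't // r'S //.
  by rewrite ltnS ltnW // rS.
- by rewrite r'S.
- move=> a q q' /setU1P[->|aS] /setU1P[->|qS] /setU1P[->|q'S] //; rewrite ?r't ?ltnn //.
  + by rewrite [edge t q]edge_sym [edge t q']edge_sym => /suniq-> // /suniq->.
  + by rewrite !r'S // => _ _; rewrite ltnNge ltnW // rS.
  + by rewrite !r'S // => _ _ _; rewrite ltnNge ltnW // rS.
  + by rewrite !r'S //; apply: rP.
Qed.

(** The vertex of largest rank on a cycle would have two distinct neighbours of smaller rank. *)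
Lemma rank_acyclic (T : sgraph) (r : T -> nat) : injective r ->
  (forall t q q', edge t q -> edge t q' -> r q < r t -> r q' < r t -> q = q') ->
  acyclic T.
Proof.
move=> r_inj rP [|x0 c0] // sc cc; set c := x0 :: c0 in sc cc.
have x0c : x0 \in c by rewrite inE eqxx.
pose m := [arg max_(i > x0 in c) r i].
have [mc mmax] : m \in c /\ {in c, forall z, r z <= r m}.
  by rewrite /m; case: arg_maxnP => // i ic imax; split.
have [i c' cE] := rot_to mc.
have memc z : (z \in c) = (z \in m :: c') by rewrite -cE mem_rot.
move: sc cc; rewrite -(size_rot i) -(rot_ucycle i) cE.
case: c' {cE} memc => [|x [|y p]] // memc _; rewrite /ucycle [in X in X -> _]/=.
case/andP=> /and3P[mx _] /=; rewrite rcons_path => /andP[_ lm] /and4P[mn xn _ _].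
have lt z : z \in c -> edge m z -> r z < r m.
  move=> zc mz; rewrite ltn_neqAle mmax // andbT.
  by apply: contraTneq mz => /r_inj->; rewrite edge_irrefl.
have xc : x \in c by rewrite memc !inE eqxx orbT.
have lc : last y p \in c by rewrite memc 2!in_cons mem_last !orbT.
rewrite edge_sym in lm.
have := rP m x (last y p) mx lm (lt x xc mx) (lt _ lc lm) => xE.
by move: xn; rewrite xE mem_last.
Qed.

Section Glue.
Variables (T1 T2 : sgraph) (c : T1) (d : T2).

Definition glue_edge (x y : T1 + T2) : bool :=
  match x, y with
  | inl a, inl b => edge a b
  | inr a, inr b => edge a b
  | inl a, inr b | inr b, inl a => (a == c) && (b == d)
  end.

Lemma glue_sym : symmetric glue_edge.
Proof. by case=> a [] b //=; rewrite edge_sym. Qed.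

Lemma glue_irrefl : irreflexive glue_edge.
Proof. by case=> a /=; rewrite edge_irrefl. Qed.

Definition glue : sgraph := SGraph glue_sym glue_irrefl.

Lemma glue_conn (A : {set T1}) (B : {set T2}) (S : {set glue}) :
  conn (@edge T1) A -> conn (@edge T2) B ->
  (forall a, (inl a \in S) = (a \in A)) -> (forall b, (inr b \in S) = (b \in B)) ->
  A = set0 \/ B = set0 \/ (c \in A /\ d \in B) -> conn (@edge glue) S.
Proof.
move=> cA cB SA SB AB.
have conA x y : x \in A -> y \in A -> connect (inside (@edge glue) S) (inl x) (inl y).
  move=> xA yA; apply: connect_homo (cA x y xA yA) => a b /and3P[aA bA ab].
  by rewrite /inside /= !SA aA bA.
have conB x y : x \in B -> y \in B -> connect (inside (@edge glue) S) (inr x) (inr y).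
  move=> xA yA; apply: connect_homo (cB x y xA yA) => a b /and3P[aA bA ab].
  by rewrite /inside /= !SB aA bA.
have conAB x y : x \in A -> y \in B -> connect (inside (@edge glue) S) (inl x) (inr y).
  case: AB => [->|[->|[cA' dB]]]; rewrite ?inE // => xA yB.
  apply: connect_trans (conA _ _ xA cA') _; apply: connect_trans (conB _ _ dB yB).
  by apply: connect1; rewrite /inside /= SA SB cA' dB !eqxx.
case=> x [] y; rewrite ?SA ?SB => xS yS; [exact: conA| exact: conAB| |exact: conB].
by rewrite (sym_connect_sym (inside_sym S glue_sym)); apply: conAB.
Qed.

Lemma glue_tree : is_tree T1 -> is_tree T2 -> is_tree glue.
Proof.
move=> tree1 tree2; have [_ c1 _] := tree1; have [_ c2 _] := tree2; split.
- by apply/card_gt0P; exists (inl c).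
- apply: (glue_conn c1 c2) => [a|b|]; rewrite ?inE //.
  by right; right.
have [r1 [r1_inj r1T _ r1P]] := tree_rank c tree1.
have [r2 [r2_inj r2T r20 r2P]] := tree_rank d tree2.
(* All of [T1] precedes [T2], which starts with [d]: the new edge gives a smaller neighbour only to
   [d], which has no other. *)
pose r (x : glue) := match x with inl a => r1 a | inr b => #|T1| + r2 b end.
have ltT a b : (r1 a < #|T1| + r2 b) by apply: leq_trans (r1T a) (leq_addr _ _).
have geT a b : (#|T1| + r2 b < r1 a) = false.
  by apply/negbTE; rewrite -leqNgt ltnW.
apply: (@rank_acyclic glue r).
- case=> [a|a] [b|b] /=; first by move/r1_inj->.
  + by move=> E; have:= ltT a b; rewrite -E ltnn.
  + by move=> E; have:= ltT b a; rewrite -E ltnn.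
  + by move/addnI/r2_inj->.
- case=> t [] q [] q' //=; rewrite ?geT ?ltn_add2l //.
  + by move=> ? ? ? ?; congr inl; apply: (r1P t).
  + by case/andP=> /eqP-> _ /andP[/eqP->].
  + by move=> /andP[_ /eqP->] _ _; rewrite r20.
  + by move=> _ /andP[_ /eqP->] ; rewrite r20.
  + by move=> ? ? ? ?; congr inr; apply: (r2P t).
Qed.

End Glue.

Section TreeDec.
Variable G : sgraph.
Implicit Types (R L P : {set G}).

(** A decomposition of the subgraph induced by [R], kept on the vertex type of [G] so that
    decompositions of both sides of a separation can be glued. *)
Definition tdec R (T : sgraph) (bag : T -> {set G}) : Prop :=
  [/\ is_tree T, forall t, bag t \subset R,
      {in R, forall v, exists t, v \in bag t},
      {in R &, forall v w, edge v w -> exists t, (v \in bag t) && (w \in bag t)}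
    & forall v, conn (@edge T) [set t | v \in bag t]].

(** Each vertex of [P] occupies a connected set of nodes, and adjacent vertices share a node. *)
Lemma conn_trace (T : sgraph) (bag : T -> {set G}) P : tdec [set: G] bag ->
  conn (@edge G) P -> conn (@edge T) [set t | ~~ [disjoint P & bag t]].
Proof.
move=> [_ _ _ eT cT] cP t t'; rewrite !inE => /pred0Pn[p /andP[/= pP pt]].
case/pred0Pn=> p' /andP[/= p'P p't'].
have trP q : q \in P -> [set t | q \in bag t] \subset [set t | ~~ [disjoint P & bag t]].
  by move=> qP; apply/subsetP=> u; rewrite !inE => qu; apply/pred0Pn; exists q; apply/andP.
have /connectP[s ps p'E] := cP p p' pP p'P.
elim: s p t pP pt ps p'E => [|q s IHs] p t pP pt /=.
  move=> _ pE; rewrite pE in p't'.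
  by apply: connect_insideS (trP p pP) (cT p t t' _ _); rewrite ?inE.
case/andP=> /and3P[_ qP pq] qs p'E; have [u /andP[pu qu]] := eT p q (in_setT p) (in_setT q) pq.
apply: connect_trans (IHs q u qP qu qs p'E).
by apply: connect_insideS (trP p pP) (cT p t u _ _); rewrite ?inE.
Qed.

(** Only vertices of the separator occur on both sides, and these lie in the bags at both ends of
    the new tree edge. *)
Lemma glue_tdec L R (T1 T2 : sgraph) (b1 : T1 -> {set G}) (b2 : T2 -> {set G}) c d :
  tdec R b1 -> tdec L b2 -> separation (@edge G) L R ->
  L :&: R \subset b1 c -> L :&: R \subset b2 d ->
  tdec [set: G] (fun t : glue c d => match t with inl a => b1 a | inr b => b2 b end).
Proof.
move=> [tr1 bR v1 e1 c1] [tr2 bL v2 e2 c2] sep /subsetP Sc /subsetP Sd; split.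
- exact: glue_tree.
- by move=> t; apply: subsetT.
- move=> v _; case/orP: (separation_or v sep) => [/v2|/v1] [t vt].
    by exists (inr t).
  by exists (inl t).
- move=> v w _ _ vw.
  have [|] := boolP ((v \in L) && (w \in L)).
    by case/andP=> vL wL; have [t vwt] := e2 v w vL wL vw; exists (inr t).
  have [|] := boolP ((v \in R) && (w \in R)).
    by case/andP=> vL wL; have [t vwt] := e1 v w vL wL vw; exists (inl t).
  have := separation_or v sep; have := separation_or w sep; have [_ s] := sep.
  have := s v w; have := s w v; rewrite [edge w v]edge_sym vw.
  by case: (v \in L); case: (v \in R); case: (w \in L); case: (w \in R) => //=;
    do ?[by move=> _ /(_ isT isT)|by move=> /(_ isT isT)].
- move=> v; apply: (glue_conn (c1 v) (c2 v)) => [a|b|]; rewrite ?inE //.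
  have [vL|vL] := boolP (v \in L); last first.
    right; left; apply/setP=> t; rewrite !inE.
    by apply: contraNF vL; apply: (subsetP (bL t)).
  have [vR|vR] := boolP (v \in R); last first.
    left; apply/setP=> t; rewrite !inE.
    by apply: contraNF vR; apply: (subsetP (bR t)).
  by right; right; rewrite Sc ?Sd // inE vL.
Qed.

End TreeDec.

(** * Tree-width duality *)

Section Duality.
Variable G : sgraph.
Implicit Types (A C D L R X Y : {set G}) (B : {set {set G}}).

Definition nbhd C : {set G} := [set v | [exists c in C, (c == v) || edge c v]].

Lemma nbhdP C v : reflect (exists2 c, c \in C & (c == v) || edge c v) (v \in nbhd C).
Proof. by rewrite inE; apply: (iffP exists_inP). Qed.

Lemma sub_nbhd C : C \subset nbhd C.
Proof. by apply/subsetP=> v vC; apply/nbhdP; exists v; rewrite ?eqxx. Qed.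

(** Asking for closed neighbourhoods on the two sides forces the separator off [C], see
    [min_sep_disjoint]. *)
Definition min_sep C D L R : Prop :=
  [/\ separation (@edge G) L R, nbhd C \subset L, nbhd D \subset R
    & forall L' R', separation (@edge G) L' R' -> nbhd C \subset L' ->
        nbhd D \subset R' -> #|L :&: R| <= #|L' :&: R'|].

Lemma min_sepC C D L R : min_sep C D L R -> min_sep D C R L.
Proof.
have es := @edge_sym G; move=> [sep CL DR minS]; split=> //.
  exact: separationC.
move=> L' R' sep' DL' CR'; rewrite setIC [L' :&: R']setIC.
by apply: minS => //; apply: separationC.
Qed.

Lemma min_sep_exists C D : [disjoint C & nbhd D] -> exists L R, min_sep C D L R.
Proof.
move=> CD; pose P (p : {set G} * {set G}) := `[< [/\ separation (@edge G) p.1 p.2,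
  nbhd C \subset p.1 & nbhd D \subset p.2] >].
have P0 : P (nbhd C, ~: C).
  apply/asboolP; split=> //=; last by rewrite -disjoints_subset disjoint_sym.
  split.
    apply/setP=> v; rewrite in_setU in_setC in_setT.
    by case: (boolP (v \in C)) => [/(subsetP (sub_nbhd C))->|]; rewrite ?orbT.
  move=> x y; rewrite inE negbK => xC; apply: contra => xy.
  by apply/nbhdP; exists x; rewrite ?xy ?orbT.
case: (@arg_minnP _ (nbhd C, ~: C) P (fun p => #|p.1 :&: p.2|) P0) => -[L R].
move=> /asboolP[/= sep CL DR] minS; exists L, R; split=> // L' R' sep' CL' DR'.
by apply: (minS (L', R')); apply/asboolP; split.
Qed.

(** A vertex of [C] in [R] could be dropped from [R], since its whole closed neighbourhood is in
    [L]; this would lower the order. *)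
Lemma min_sep_disjoint C D L R : [disjoint C & nbhd D] -> min_sep C D L R ->
  [disjoint C & R].
Proof.
move=> CD [[LR sLR] CL DR minS]; apply/pred0P=> v; apply/negP=> /andP[/= vC vR].
have vL : v \in L by apply: (subsetP CL); apply: (subsetP (sub_nbhd C)).
have : #|L :&: R| <= #|L :&: (R :\ v)|.
  apply: minS => //; last first.
    rewrite subsetD1 DR /=; apply/negP=> vD.
    by have /pred0P/(_ v) := CD; rewrite /= vC vD.
  split.
    apply/setP=> z; have /setP/(_ z) := LR; rewrite !inE.
    by case: (eqVneq z v) => [->|_] //=; rewrite vL.
  move=> x y; rewrite !inE negb_and negbK => /orP[/eqP->|]; last exact: sLR.
  by apply: contra => vy; apply: (subsetP CL); apply/nbhdP; exists v; rewrite ?vy ?orbT.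
apply/negP; rewrite -ltnNge; apply: proper_card; apply/properP; split.
  by apply: setIS; apply: subsetDl.
by exists v; rewrite !inE ?vL ?eqxx.
Qed.

(** [E t] is the part of a bag that is exempt from the size bound. Once the bags cover [G], privacy
    itself forces [E t] into [bag t]. *)
Definition private T (bag E : T -> {set G}) : Prop :=
  forall t t' v, v \in E t -> v \in bag t' -> t' = t.

(* The separator [L :&: R] is linked to the neighbourhood of [C] inside [L] by
   disjoint connected sets; contracting each of them onto its end in the
   separator turns a decomposition of [G] into one of [G[R]]. *)
Lemma restrict_tdec C D L R (T : sgraph) (bag E : T -> {set G}) c :
  tdec [set: G] bag -> private bag E -> [disjoint C & nbhd D] ->
  min_sep C D L R -> C \subset E c ->
  (forall v w, v \in C -> edge v w -> w \in E c -> w \in C) ->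
  exists bag' : T -> {set G}, [/\ tdec R bag', L :&: R \subset bag' c,
    forall t, #|bag' t :\: (E t :\: L)| <= #|bag t :\: E t|
  & forall t v, v \in bag' t -> v \notin L -> v \in bag t].
Proof.
have es := @edge_sym G; move=> tb pE CD mS CE Cclosed.
have CR := min_sep_disjoint CD mS.
have [sep CL DR minS] := mS; have [trT _ vT eT cT] := tb.
have Eb t : E t \subset bag t.
  apply/subsetP=> v vE; have [t' vt'] := vT v (in_setT v).
  by rewrite -(pE t t' v vE vt').
(* The vertices of [C] lie in no bag but that of [c], so this bag has to cover all their edges. *)
have nCb : nbhd C \subset bag c.
  apply/subsetP=> w /nbhdP[v vC /orP[/eqP<-|vw]].
    by apply: (subsetP (Eb c)); apply: (subsetP CE).
  have [t /andP[vt wt]] := eT v w (in_setT v) (in_setT w) vw.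
  by rewrite -(pE c t v (subsetP CE _ vC) vt).
set S := L :&: R.
(* A smaller separation between [nbhd C] and [S], combined with [(L, R)], would contradict the
   minimality of [(L, R)]. *)
have [|M [MP Mdis]] := linked_onto (@menger G (@edge G) (nbhd C) S #|S| es _) erefl.
  move=> L1 R1 sep1 CL1 SR1.
  have sepe : separation (@edge G) (L1 :&: L) (R1 :|: R).
    have [_ s1] := sep1; have [_ s] := sep; split.
      apply/setP=> z; have := separation_or z sep; have := separation_or z sep1.
      by rewrite !inE; case: (z \in L1); case: (z \in L); case: (z \in R1); case: (z \in R).
    move=> x y; rewrite !inE negb_or negb_and => /andP[xR1 xR] /orP[yL|yL].
      exact: s1.
    exact: s.
  apply: leq_trans (minS _ _ sepe _ _) _.
  - by rewrite subsetI CL1.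
  - exact: subset_trans DR (subsetUr _ _).
  - apply: subset_leq_card; apply/subsetP=> z; rewrite !inE => /andP[/andP[zL1 zL]].
    by rewrite zL1 => /orP[//|zR]; apply: (subsetP SR1); rewrite inE zL.
(* For [v] in [R], [mu v] is the branch set contracted onto [v]; [v] enters the new bags at the
   nodes whose bags meet it. *)
pose mu v := if v \in S then M v :&: L else [set v].
have muR v : v \in R -> v \in mu v.
  move=> vR; rewrite /mu; case: ifP => vS; last by rewrite inE.
  by have [vM _ _] := MP v vS; move: vS; rewrite !inE vM => /andP[].
have trim := conn_trim_family es sep CL (subxx S) (subsetIl _ _) MP Mdis.
have cmu v : conn (@edge G) (mu v).
  by rewrite /mu; case: ifP => [/trim[]//|_]; apply: conn1.
have muC v : v \in S -> exists2 z, z \in mu v & z \in nbhd C.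
  move=> vS; have [_ _ /pred0Pn[z /andP[/= zM zC]]] := MP v vS.
  by exists z => //; rewrite /mu vS inE zM (subsetP CL).
have mudis v w z : v \in R -> w \in R -> z \in mu v -> z \in mu w -> v = w.
  rewrite /mu => vR wR; case: ifPn => vS; case: ifPn => wS.
  - by move=> /setIP[zv _] /setIP[zw _]; apply: Mdis zv zw.
  - by move=> /setIP[_ zL] /set1P zw; rewrite -zw inE zL zw wR in wS.
  - by move=> /set1P zw /setIP[_ zL]; rewrite -zw inE zL zw vR in vS.
  - by move=> /set1P<- /set1P<-.
pose bag' t := [set v in R | ~~ [disjoint mu v & bag t]].
have bagb t v : v \in R -> v \in bag t -> v \in bag' t.
  by move=> vR vt; rewrite inE vR; apply/pred0Pn; exists v; rewrite /= muR.
exists bag'; split.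
- split=> //.
  + by move=> t; apply/subsetP=> v; rewrite inE => /andP[].
  + by move=> v vR; have [t vt] := vT v (in_setT v); exists t; apply: bagb.
  + move=> v w vR wR vw; have [t /andP[vt wt]] := eT v w (in_setT v) (in_setT w) vw.
    by exists t; rewrite !bagb.
  + move=> v; have [vR|vR] := boolP (v \in R).
      suff -> : [set t | v \in bag' t] = [set t | ~~ [disjoint mu v & bag t]].
        exact: conn_trace tb (cmu v).
      by apply/setP=> t; rewrite !inE vR.
    by move=> s t; rewrite !inE (negPf vR).
- apply/subsetP=> v vS; have [z zv zC] := muC v vS; have /setIP[_ vR] := vS.
  by rewrite inE vR; apply/pred0Pn; exists z; rewrite /= zv (subsetP nCb).
(* Each counted vertex [v] of the new bag is charged to a vertex of [mu v] counted in the old one;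
   the charging is injective because branch sets are disjoint. *)
- move=> t; set W := bag t :\: E t; set W' := _ :\: (_ :\: _).
  have W'R v : v \in W' -> v \in R by rewrite !inE => /andP[_ /andP[]].
  have meetW v : v \in W' -> exists2 z, z \in mu v & z \in W.
    move=> vW'; have vR := W'R v vW'; move: vW'; rewrite !inE negb_and negbK vR /=.
    have [vL|vL] /= := boolP (v \in L); last first.
      have -> : mu v = [set v] by rewrite /mu inE (negPf vL).
      move=> /andP[vE /pred0Pn[w /andP[/set1P-> vt]]].
      by exists v; rewrite !inE ?eqxx // vE.
    (* If [mu v] met the bag only in [E t], privacy would trap the connected set [mu v] in [E t]. As
       it meets [nbhd C], this gives [t = c], and closure of [C] in [E c] puts [v] into [C], which
       misses [R]. *)
    move=> /pred0Pn[x /andP[/= xv xt]]; apply: contrapT => noW.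
    have muE w : w \in mu v -> w \in bag t -> w \in E t.
      by move=> wv wt; apply: contrapT => /negP wE; apply: noW; exists w; rewrite // inE wE.
    have vS : v \in S by rewrite inE vL.
    have subE : {in mu v, forall w, w \in E t}.
      apply: (conn_stable (P := mem (E t)) (cmu v) xv); first exact: muE.
      move=> a b av bv /= aE ab; apply: muE => //.
      have [t' /andP[at' bt']] := eT a b (in_setT a) (in_setT b) ab.
      by rewrite -(pE t t' a aE at').
    have [z zv zC] := muC v vS.
    have ct : c = t := pE t c z (subE z zv) (subsetP nCb z zC).
    have zC' : z \in C.
      case/nbhdP: zC => w wC /orP[/eqP<-//|wz].
      by apply: Cclosed wC wz _; rewrite ct subE.
    have vC : v \in C.
      apply: (conn_stable (P := mem C) (cmu v) zv zC' _ (muR v vR)) => a b av bv aC ab.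
      by apply: Cclosed aC ab _; rewrite ct subE.
    by have /pred0P/(_ v) := CR; rewrite /= vC vR.
  pose g v := odflt v [pick z in mu v | z \in W].
  have gP v : v \in W' -> g v \in mu v /\ g v \in W.
    move=> /meetW[z zv zW]; rewrite /g; case: pickP => [y /andP[]//|/(_ z)].
    by rewrite /= zv zW.
  have ginj : {in W' &, injective g}.
    move=> v w vW wW gvw; have [vg _] := gP v vW; have [wg _] := gP w wW.
    by apply: mudis (W'R v vW) (W'R w wW) vg _; rewrite gvw.
  rewrite -(card_in_imset ginj); apply: subset_leq_card.
  by apply/subsetP=> _ /imsetP[v vW ->]; case: (gP v vW).
- move=> t v; rewrite inE => /andP[vR vt] vL; move: vt.
  have -> : mu v = [set v] by rewrite /mu inE (negPf vL).
  by case/pred0Pn=> w /andP[/set1P->].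
Qed.

(** When [B] contains all singletons, the private parts must be empty and this is an ordinary
    decomposition into bags of size at most [K]. *)
Definition avoidable K B : Prop := exists (T : sgraph) (bag E : T -> {set G}),
  [/\ tdec [set: G] bag, private bag E, forall t, #|bag t :\: E t| <= K
    & forall t A, A \in B -> ~~ (A \subset E t)].

Definition unavoidable_filter K B : Prop :=
  [/\ forall A, A \in B -> A != set0 /\ conn (@edge G) A,
      forall A A', A \in B -> A \subset A' -> conn (@edge G) A' -> A' \in B
    & ~ avoidable K B].

(** Removing a minimal member [C] keeps [B] upward closed, so minimality of [B] yields a
    decomposition avoiding the rest; as [B] is unavoidable, [C] lies in some [E c]. A neighbour of
    [C] in [E c] could be added to [C], giving another member inside [E c], hence [C] again. *)
Lemma almost_avoidable K B C : minset [pred B | `[< unavoidable_filter K B >]] B ->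
  minset (mem B) C -> exists (T : sgraph) (bag E : T -> {set G}) c,
  [/\ tdec [set: G] bag, private bag E, forall t, #|bag t :\: E t| <= K &
  [/\ forall t A, A \in B -> A \subset E t -> A = C, C \subset E c &
      forall v w, v \in C -> edge v w -> w \in E c -> w \in C]].
Proof.
have es := @edge_sym G.
move=> /minsetP[/asboolP[Bc Bup nB] Bmin] /minsetP[CB Cmin].
have [T [bag [E [tb pE bE avE]]]] : avoidable K (B :\ C).
  apply: contrapT => nav; have : B :\ C = B.
    apply: Bmin; last exact: subsetDl.
    apply/asboolP; split=> //.
      by move=> A /setD1P[_ /Bc].
    move=> A A' /setD1P[AC AB] AA' cA'; rewrite !inE (Bup A) // andbT.
    by apply: contra_neqN AC => /eqP A'C; apply/Cmin; rewrite -?A'C.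
  by move/setP/(_ C); rewrite !inE eqxx [C \in B]CB.
have onlyC t A : A \in B -> A \subset E t -> A = C.
  move=> AB AE; apply: contrapT => /eqP AC; have := avE t A.
  by rewrite !inE AC AB AE => /(_ isT).
have [c Cc] : exists c, C \subset E c.
  apply: contrapT => nc; apply: nB; exists T, bag, E; split=> // t A AB.
  apply/negP=> AE; apply: nc; exists t.
  by rewrite -(onlyC t A AB AE).
exists T, bag, E, c; split=> //; split=> // v w vC vw wE.
have [_ cC] := Bc C CB.
have : w |: C \in B.
  apply: (Bup C) => //; first exact: subsetUr.
  apply: (connU es (@conn1 _ _ w) cC (set11 w) vC); by rewrite es vw orbT.
by move/(onlyC c) => <-; rewrite ?setU11 // subUset sub1set wE.
Qed.

Lemma minimal_filter_touching K B :
  minset [pred B | `[< unavoidable_filter K B >]] B ->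
  {in B &, forall C D, conn (@edge G) (C :|: D)}.
Proof.
have es := @edge_sym G.
move=> Bmin C0 D0 C0B D0B; have [/asboolP[Bc Bup nB] _] := minsetP Bmin.
apply: contrapT => notouch.
(* Minimal members inside two sets that do not touch do not touch either. *)
have [C Cmin CC0] := @minset_exists _ (mem B) C0 C0B.
have [D Dmin DD0] := @minset_exists _ (mem B) D0 D0B.
have CD : [disjoint C & nbhd D].
  apply/pred0P=> v; apply/negP=> /andP[/= vC /nbhdP[w wD wv]]; apply: notouch.
  have [[_ cC0] [_ cD0]] := (Bc C0 C0B, Bc D0 D0B).
  apply: (connU es cC0 cD0 (subsetP CC0 v vC) (subsetP DD0 w wD)).
  by rewrite eq_sym es.
have DC : [disjoint D & nbhd C].
  apply/pred0P=> w; apply/negP=> /andP[/= wD /nbhdP[v vC vw]].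
  have /pred0P/(_ v) := CD; rewrite /= vC; move/negP; apply; apply/nbhdP.
  by exists w; rewrite // eq_sym es.
have [L [R LR]] := min_sep_exists CD.
have [sep CL DR _] := LR.
have [CB _] := minsetP Cmin; have [DB _] := minsetP Dmin.
have [T1 [bag1 [E1 [c [tb1 pE1 bE1 [only1 Cc Ccl]]]]]] := almost_avoidable Bmin Cmin.
have [T2 [bag2 [E2 [d [tb2 pE2 bE2 [only2 Dd Dcl]]]]]] := almost_avoidable Bmin Dmin.
have [b1 [tb1' Sc sz1 bb1]] := restrict_tdec tb1 pE1 CD LR Cc Ccl.
have [b2 [tb2' Sd sz2 bb2]] := restrict_tdec tb2 pE2 DC (min_sepC LR) Dd Dcl.
rewrite setIC in Sd; have [_ b1R _ _ _] := tb1'; have [_ b2L _ _ _] := tb2'.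
apply: nB; exists (glue c d), (fun t => match t with inl a => b1 a | inr b => b2 b end).
(* A member inside a new private part would be [C] or [D], but [C] lies in the removed set [L] and
   [D] in the removed set [R]. *)
exists (fun t => match t with inl a => E1 a :\: L | inr b => E2 b :\: R end); split.
- exact: glue_tdec tb1' tb2' sep Sc Sd.
- move=> [a|b] [a'|b'] v /setDP[vE vL] vb.
  + by congr inl; apply: pE1 vE (bb1 _ _ vb vL).
  + by rewrite (subsetP (b2L b')) in vL.
  + by rewrite (subsetP (b1R a')) in vL.
  + by congr inr; apply: pE2 vE (bb2 _ _ vb vL).
- by case=> [a|b]; [apply: leq_trans (sz1 a) _|apply: leq_trans (sz2 b) _].
- case=> [a|b] A AB; rewrite subsetD; apply/negP=> /andP[AE AL].
    have AC := only1 a A AB AE; have [/set0Pn[v vA] _] := Bc A AB.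
    have /pred0P/(_ v) := AL; rewrite /= vA (subsetP CL) //.
    by apply: (subsetP (sub_nbhd C)); rewrite -AC.
  have AC := only2 b A AB AE; have [/set0Pn[v vA] _] := Bc A AB.
  have /pred0P/(_ v) := AL; rewrite /= vA (subsetP DR) //.
  by apply: (subsetP (sub_nbhd D)); rewrite -AC.
Qed.

(** This is a haven of order [k + 1], with a vertex representing each component. The robber escapes
    from [r Y] to [r X] while only the cops on [Y] are in place. *)
Definition haven k (r : {set G} -> G) : Prop := forall X Y, #|X| <= k -> Y \subset X ->
  r X \notin X /\ connect (inside (@edge G) (~: Y)) (r Y) (r X).

Lemma haven_exists k : ~ treewidth_at_most k G -> exists r, haven k.+1 r.
Proof.
have es := @edge_sym G; move=> twG.
pose B0 := [set A : {set G} | (A != set0) && `[< conn (@edge G) A >]].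
(* [B0] contains the singletons, so a decomposition avoiding it has empty private parts and width at
   most [k]. *)
have filter0 : unavoidable_filter k.+1 B0.
  split.
  - by move=> A; rewrite inE => /andP[? /asboolP].
  - move=> A A'; rewrite !inE => /andP[/set0Pn[v vA] _] AA' cA'.
    by apply/andP; split; [apply/set0Pn; exists v; apply: (subsetP AA')|apply/asboolP].
  move=> [T [bag [E [[trT _ vT eT cT] pE bE avE]]]]; apply: twG.
  have E0 t : E t = set0.
    apply/eqP/set0Pn=> -[v vE]; have vB : [set v] \in B0.
      by rewrite inE -card_gt0 cards1; apply/asboolP/(@conn1 _ _ v).
    by have := avE t [set v] vB; rewrite sub1set vE.
  apply/treewidth_leP.
  have vT' v : exists t, v \in bag t by apply: vT; rewrite inE.
  have eT' v w : edge v w -> exists t, (v \in bag t) && (w \in bag t).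
    by move=> vw; apply: eT; rewrite ?inE.
  exists (TreeDecomposition trT vT' eT' cT); rewrite /width -subn1 leq_subLR add1n.
  apply/bigmax_leqP=> t _; have := bE t.
  by rewrite E0 setD0.
have [B Bmin _] := @minset_exists _ [pred B | `[< unavoidable_filter k.+1 B >]] B0
  (introT (asboolP _) filter0).
have touch := minimal_filter_touching Bmin.
have [/asboolP[Bc Bup nB] _] := minsetP Bmin.
(* If every member met [X], the one-node decomposition with private part [~: X] would avoid [B]. *)
have hit X : #|X| <= k.+1 -> exists A r, [/\ A \in B, [disjoint A & X] & r \in A].
  move=> Xk; apply: contrapT => nohit; apply: nB.
  pose T := @SGraph unit (fun _ _ => false) (fun _ _ => erefl) (fun _ => erefl).
  exists T, (fun=> setT), (fun=> ~: X); split.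
  - split=> //.
    + split; first by rewrite card_unit.
        by move=> [] [] _ _; apply: connect0.
      by case=> [|x [|y [|z c]]].
    + by move=> v w _ _ _; exists tt; rewrite !inE.
    + by move=> v [] [] _ _; apply: connect0.
  - by move=> [] [].
  - by move=> _; rewrite setTD setCK.
  - move=> _ A AB; rewrite -disjoints_subset; apply/negP=> AX; apply: nohit.
    by have [/set0Pn[v vA] _] := Bc A AB; exists A, v.
have [|A0 [r0 _]] := hit set0; first by rewrite cards0.
have /choice[f fP] : forall X, exists p : {set G} * G,
    #|X| <= k.+1 -> [/\ p.1 \in B, [disjoint p.1 & X] & p.2 \in p.1].
  move=> X; have [Xk|Xk] := boolP (#|X| <= k.+1); last by exists (A0, r0).
  by have [A [r ?]] := hit X Xk; exists (A, r).
exists (fun X => (f X).2) => X Y Xk YX.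
have [AB AX rA] := fP X Xk.
have [AB' AX' rA'] := fP Y (leq_trans (subset_leq_card YX) Xk).
split; first by have /pred0P/(_ (f X).2) := AX; rewrite /= rA => /negbT.
(* The members chosen for [Y] and [X] both miss [Y], and their union is connected. *)
apply: connect_insideS (touch _ _ AB' AB _ _ _ _) => //; last 2 first.
- by rewrite inE rA'.
- by rewrite inE rA orbT.
rewrite -disjoints_subset disjoints_subset subUset -!disjoints_subset AX' /=.
by rewrite disjoint_sym (disjointWl YX) // disjoint_sym.
Qed.

End Duality.

(** * Lifting homomorphisms *)

Section SymDiff.
Variable T : finType.
Implicit Types A B : {set T}.

Definition symdiff A B : {set T} := [set x | (x \in A) (+) (x \in B)].

Lemma symdiffK B : involutive (symdiff^~ B).
Proof. by move=> A; apply/setP=> x; rewrite !inE addbK. Qed.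

Lemma odd_symdiff A B : odd #|symdiff A B| = odd #|A| (+) odd #|B|.
Proof.
have -> : symdiff A B = (A :\: B) :|: (B :\: A).
  by apply/setP=> x; rewrite !inE; case: (x \in A); case: (x \in B).
rewrite -(cardsID B A) -(cardsID A B) cardsU [B :&: A]setIC.
have -> : (A :\: B) :&: (B :\: A) = set0.
  by apply/setP=> x; rewrite !inE; case: (x \in A); case: (x \in B).
by rewrite cards0 subn0 !oddD addbACA addbb.
Qed.

End SymDiff.

Section Lifts.
Variable G : sgraph.

(* The edge set of a subgraph of [G] whose vertices of odd degree are [a] and
   [b] (none if [a = b]), given by the set of neighbours of each vertex. *)
Definition chain (P : G -> {set G}) (a b : G) : Prop :=
  [/\ forall v w, w \in P v -> edge v w, forall v w, (w \in P v) = (v \in P w)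
    & forall v, odd #|P v| = (v == a) (+) (v == b)].

Lemma chain_trans P Q a b c : chain P a b -> chain Q b c ->
  chain (fun v => symdiff (P v) (Q v)) a c.
Proof.
move=> [eP sP oP] [eQ sQ oQ]; split.
- move=> v w; rewrite inE; case: (boolP (w \in P v)) => [/eP//|_ /=].
  exact: eQ.
- by move=> v w; rewrite !inE sP sQ.
- by move=> v; rewrite odd_symdiff oP oQ addbA addbK.
Qed.

(** The edges of a walk, taken modulo 2, form a chain between its ends; edges at [Y] never occur. *)
Lemma connect_chain (Y : {set G}) a b : connect (inside (@edge G) (~: Y)) a b ->
  exists2 P, chain P a b & {in Y, forall v, P v = set0}.
Proof.
case/connectP=> p; elim: p a => [|c p IHp] a /=.
  move=> _ ->; exists (fun=> set0) => //; split=> [v w|v w|v]; rewrite ?inE //.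
  by rewrite cards0 addbb.
case/andP=> /and3P[aY cY ac] /IHp/[apply] -[P cP PY].
have ca : c != a by apply: contraTneq ac => ->; rewrite edge_irrefl.
pose Q v := if v == a then [set c] else if v == c then [set a] else set0.
exists (fun v => symdiff (Q v) (P v)).
  apply: chain_trans cP; split=> [v w|v w|v]; rewrite /Q.
  - case: eqP => [->|_]; first by move/set1P->.
    by case: eqP => [->|_]; rewrite ?inE // => /eqP->; rewrite edge_sym.
  - case: (eqVneq v a) => [->|va]; case: (eqVneq w a) => [->|wa];
      rewrite ?inE ?eqxx ?(negPf ca) // ?(eq_sym a) ?(negPf ca) //.
    + by case: (eqVneq w c); rewrite ?inE ?eqxx.
    + by case: (eqVneq v c); rewrite ?inE ?eqxx.
    + by case: (eqVneq v c); case: (eqVneq w c); rewrite ?inE ?(negPf va) ?(negPf wa).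
  - case: (eqVneq v a) => [->|va]; first by rewrite cards1 eq_sym (negPf ca).
    by case: (eqVneq v c); rewrite ?cards1 ?cards0.
move=> v vY; rewrite /Q PY //.
have -> : (v == a) = false by apply: contraTF aY => /eqP <-; rewrite inE negbK.
have -> : (v == c) = false by apply: contraTF cY => /eqP <-; rewrite inE negbK.
by apply/setP=> z; rewrite !inE.
Qed.

(** [sigma x] is the second coordinate of a CFI vertex over [phi x], and [tw] marks the twisted
    vertices; the last clause is adjacency of CFI vertices. *)
Definition is_lift (F : sgraph) (tw : pred G) (phi : F -> G) (sigma : F -> {set G}) : bool :=
  [forall x, (sigma x \subset [set w | edge (phi x) w]) &&
             (odd #|sigma x| == tw (phi x))] &&
  [forall x, forall y, edge x y ==> ((phi y \in sigma x) == (phi x \in sigma y))].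

Lemma is_liftP (F : sgraph) tw (phi : F -> G) (sigma : F -> {set G}) :
  reflect [/\ forall x w, w \in sigma x -> edge (phi x) w,
              forall x, odd #|sigma x| = tw (phi x)
            & forall x y, edge x y -> (phi y \in sigma x) = (phi x \in sigma y)]
          (is_lift tw phi sigma).
Proof.
apply: (iffP andP) => [[/forallP h1 /'forall_forallP h2]|[h1 h2 h3]].
  split=> [x w wx|x|x y xy].
  - by have /andP[/subsetP/(_ w wx)] := h1 x; rewrite inE.
  - by have /andP[_ /eqP] := h1 x.
  - by have := h2 x y; rewrite xy => /eqP.
split; apply/forallP=> x.
  by rewrite h2 eqxx andbT; apply/subsetP=> w /h1; rewrite inE.
by apply/forallP=> y; apply/implyP=> /h3->.
Qed.

(* [r] gives the robber's position against cops on the image of a bag. The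
   chains from [r set0] to these positions are chosen along the tree so that
   they agree, across an edge of the tree, at the images of the common vertices
   of its two bags. *)
Lemma haven_lift (F : sgraph) k (r : {set G} -> G) (phi : F -> G) :
  haven k.+1 r -> treewidth_at_most k F ->
  exists sigma, is_lift (pred1 (r set0)) phi sigma.
Proof.
move=> hr /treewidth_leP[[T bag trT vT eT cT] /= wD].
pose X t := phi @: bag t.
have Xk t : #|X t| <= k.+1.
  apply: leq_trans (leq_imset_card _ _) _.
  move: wD; rewrite /width /= -subn1 leq_subLR add1n.
  by apply: leq_trans; apply: (@leq_bigmax _ (fun t => #|bag t|) t).
have [t0 _] : exists t0, t0 \in T by have [/card_gt0P] := trT.
have [P cP aP] : exists2 P : T -> G -> {set G},
    {in [set: T], forall t, chain (P t) (r set0) (r (X t))} &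
    {in [set: T] &, forall s t, edge s t ->
       forall x, x \in bag s -> x \in bag t -> P s (phi x) = P t (phi x)}.
  apply: (tree_ind (t0 := t0) (P := fun S => exists2 P : T -> G -> {set G},
    {in S, forall t, chain (P t) (r set0) (r (X t))} &
    {in S &, forall s t, edge s t ->
       forall x, x \in bag s -> x \in bag t -> P s (phi x) = P t (phi x)})) => //.
    have [_ /connect_chain[P cP _]] := hr (X t0) set0 (Xk t0) (sub0set _).
    exists (fun=> P); first by move=> t /set1P->.
    by move=> s t /set1P-> /set1P->.
  move=> S s t [P cP aP] _ sS tS st uniq_s.
  pose Y := phi @: (bag s :&: bag t).
  (* Both positions are reachable from [r Y] off [Y], so the chain at [s] extends to one at [t]
     without changing on [Y]. *)
  have [Q cQ QY] : exists2 Q, chain Q (r (X s)) (r (X t)) & {in Y, forall v, Q v = set0}.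
    apply: connect_chain.
    have YXs : Y \subset X s by apply: imsetS; apply: subsetIl.
    have YXt : Y \subset X t by apply: imsetS; apply: subsetIr.
    have [_ cs] := hr (X s) Y (Xk s) YXs; have [_ ct] := hr (X t) Y (Xk t) YXt.
    apply: connect_trans ct.
    by rewrite (sym_connect_sym (inside_sym _ (@edge_sym G))).
  pose P' u := if u == t then fun v => symdiff (P s v) (Q v) else P u.
  have P'S u : u \in S -> P' u = P u.
    by move=> uS; rewrite /P'; case: eqP => // ut; rewrite -ut uS in tS.
  have P't x : x \in bag s -> x \in bag t -> P' t (phi x) = P s (phi x).
    move=> xs xt; rewrite /P' eqxx QY; last by apply: imset_f; rewrite inE xs.
    by apply/setP=> z; rewrite !inE addbF.
  exists P'.
    move=> u /setU1P[->|uS]; last by rewrite P'S //; apply: cP.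
    by rewrite /P' eqxx; apply: chain_trans (cP s sS) cQ.
  move=> u v /setU1P[->|uS] /setU1P[->|vS] // uv x xu xv.
  - have vs : v = s by apply: uniq_s => //; rewrite edge_sym.
    by rewrite (P'S v) // vs P't // -vs.
  - have us : u = s by apply: uniq_s.
    by rewrite (P'S u) // us P't // -us.
  - by rewrite !P'S //; apply: aP.
have agree x t t' : x \in bag t -> x \in bag t' -> P t (phi x) = P t' (phi x).
  move=> xt xt'; have /connectP[p] : connect (inside (@edge T) [set t | x \in bag t]) t t'.
    by apply: (cT x); rewrite inE.
  elim: p t xt => [|u p IHp] t xt /=; first by move=> _ ->.
  case/andP=> /and3P[_]; rewrite inE => xu tu up t'E.
  by rewrite (aP t u _ _ tu) ?inE // IHp.
pose tt x := sval (cid (vT x)); have ttP x : x \in bag (tt x) by rewrite /tt; case: cid.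
exists (fun x => P (tt x) (phi x)); apply/is_liftP; split.
- by move=> x w; have [eP _ _] := cP (tt x) (in_setT _); apply: eP.
(* The robber's position avoids the image of the bag, which contains [phi x]; only the end [r set0]
   can make the degree at [phi x] odd. *)
- move=> x; have [_ _ ->] := cP (tt x) (in_setT _).
  have [rX _] := hr (X (tt x)) set0 (Xk _) (sub0set _).
  have -> : (phi x == r (X (tt x))) = false.
    by apply: contraNF rX => /eqP<-; apply: imset_f.
  by rewrite addbF.
- move=> x y xy; have [t /andP[xt yt]] := eT x y xy.
  rewrite (agree x (tt x) t) // (agree y (tt y) t) //.
  by have [_ sP _] := cP t (in_setT _); apply: sP.
Qed.

Lemma odd_sum (I : finType) (f : I -> nat) : odd (\sum_i f i) = odd (\sum_i odd (f i)).
Proof.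
by elim/big_rec2: _ => // i m n _ mn; rewrite !oddD mn oddb.
Qed.

(** Ordered adjacent pairs split by rank into two halves that reversal exchanges. *)
Lemma handshake (P : G -> {set G}) : (forall v, v \notin P v) ->
  (forall v w, (w \in P v) = (v \in P w)) -> ~~ odd (\sum_v #|P v|).
Proof.
move=> nP sP; pose rk (v : G) : nat := enum_rank v.
have -> : \sum_v #|P v| = \sum_v \sum_w (w \in P v) * (rk v < rk w) +
                         \sum_v \sum_w (w \in P v) * (rk w < rk v).
  rewrite -big_split; apply: eq_bigr => v _; rewrite -big_split /= -sum1_card big_mkcond.
  apply: eq_bigr => w _; case: (boolP (w \in P v)) => // wv; rewrite !mul1n.
  case: (ltngtP (rk v) (rk w)) => // /val_inj/enum_rank_inj vw.
  by rewrite vw (negPf (nP w)) in wv.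
rewrite [X in _ + X]exchange_big oddD.
rewrite [X in _ (+) odd X](eq_bigr (fun v => \sum_w (w \in P v) * (rk v < rk w))) ?addbb //.
by move=> v _; apply: eq_bigr => w _; rewrite sP.
Qed.

(** Such a lift would be a subgraph of [G] whose only vertex of odd degree is [u]. *)
Lemma id_not_lift u (sigma : G -> {set G}) : ~~ is_lift (pred1 u) id sigma.
Proof.
apply/is_liftP=> -[eS oS sS].
have symS v w : (w \in sigma v) = (v \in sigma w).
  apply/idP/idP=> h; have := eS _ _ h; first by move/sS=> <-.
  by move/sS=> <-.
have := handshake (P := sigma) _ symS; rewrite odd_sum.
rewrite (eq_bigr (fun v => (v == u) : nat)); last by move=> v _; rewrite oS.
rewrite (bigD1 u) //= eqxx big1 => [/(_ _)/negP|v /negPf-> //]; apply=> // v.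
by apply/negP=> /eS; rewrite edge_irrefl.
Qed.

End Lifts.

(** * CFI graphs *)

Section CFI.
Variables (G : sgraph) (tw : pred G).

(* Sets of edges incident to [v] are represented by sets of neighbours of [v]. *)
Definition cfi_vertex := {p : G * {set G} |
  (p.2 \subset [set w | edge p.1 w]) && (odd #|p.2| == tw p.1)}.

Definition cfi_edge (x y : cfi_vertex) : bool :=
  edge (val x).1 (val y).1 &&
  (((val y).1 \in (val x).2) == ((val x).1 \in (val y).2)).

Lemma cfi_sym : symmetric cfi_edge.
Proof. by move=> x y; rewrite /cfi_edge edge_sym eq_sym. Qed.

Lemma cfi_irrefl : irreflexive cfi_edge.
Proof. by move=> x; rewrite /cfi_edge edge_irrefl. Qed.

Definition cfi : sgraph := SGraph cfi_sym cfi_irrefl.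

Definition lifts (F : sgraph) (phi : F -> G) : {set {ffun F -> {set G}}} :=
  [set sigma : {ffun F -> {set G}} | is_lift tw phi sigma].

(** The two coordinates of a homomorphism into the CFI graph are a homomorphism to [G] and a lift of
    it. *)
Lemma hom_cfi (F : sgraph) :
  hom F cfi = \sum_(phi : {ffun F -> G} | is_hom phi) #|lifts phi|.
Proof.
pose D := [set p : {ffun F -> G} * {ffun F -> {set G}} | is_hom p.1 && is_lift tw p.1 p.2].
have -> : \sum_(phi : {ffun F -> G} | is_hom phi) #|lifts phi| = #|D|.
  rewrite -sum1_card (eq_bigl (fun p : {ffun F -> G} * {ffun F -> {set G}} =>
      is_hom p.1 && is_lift tw p.1 p.2)).
    rewrite -(pair_big_dep (fun phi : {ffun F -> G} => is_hom phi)
      (fun phi (sigma : {ffun F -> {set G}}) => is_lift tw phi sigma) (fun _ _ => 1)) /=.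
    by apply: eq_bigr => phi _; rewrite -sum1_card; apply: eq_bigl => s; rewrite inE.
  by move=> p; rewrite inE.
pose h (f : {ffun F -> cfi}) : {ffun F -> G} * {ffun F -> {set G}} :=
  ([ffun x => (val (f x)).1], [ffun x => (val (f x)).2]).
have h_inj : injective h.
  move=> f g [/ffunP f1 /ffunP f2]; apply/ffunP=> x; apply: val_inj.
  have := f2 x; have := f1 x; rewrite !ffunE => E1 E2.
  by rewrite [LHS]surjective_pairing E1 E2 -surjective_pairing.
rewrite /hom -(card_imset _ h_inj); apply: eq_card => -[phi sigma].
rewrite [RHS]inE /=; apply/imsetP/andP.
  case=> f; rewrite inE => /'forall_forallP fh [-> ->]; split.
    apply/'forall_forallP=> x y; apply/implyP=> xy; have := fh x y; rewrite xy !ffunE.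
    by case/andP.
  apply/is_liftP; split=> [x w|x|x y xy]; rewrite !ffunE.
  - have /andP[/subsetP fx _] := valP (f x).
    by move/fx; rewrite inE.
  - by have /andP[_ /eqP] := valP (f x).
  - have := fh x y; rewrite xy.
    by case/andP=> _ /eqP.
case=> /'forall_forallP homphi /is_liftP[es os ss].
have vP x : (sigma x \subset [set w | edge (phi x) w]) && (odd #|sigma x| == tw (phi x)).
  by rewrite os eqxx andbT; apply/subsetP=> w /es; rewrite inE.
exists [ffun x => Sub (phi x, sigma x) (vP x)].
  rewrite inE; apply/'forall_forallP=> x y; apply/implyP=> xy; rewrite !ffunE.
  rewrite /= /cfi_edge /= ss // eqxx andbT.
  by have := homphi x y; rewrite xy.
by congr pair; apply/ffunP=> x; rewrite !ffunE.
Qed.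

End CFI.

Section Count.
Variables (G F : sgraph).

Lemma is_lift_add (tw tw' : pred G) (phi : F -> G) (s s' : F -> {set G}) :
  is_lift tw phi s -> is_lift tw' phi s' ->
  is_lift (fun v => tw v (+) tw' v) phi (fun x => symdiff (s x) (s' x)).
Proof.
move=> /is_liftP[e1 o1 s1] /is_liftP[e2 o2 s2]; apply/is_liftP; split.
- by move=> x w; rewrite inE; case: (boolP (w \in s x)) => [/e1//|_ /=]; apply: e2.
- by move=> x; rewrite odd_symdiff o1 o2.
- by move=> x y xy; rewrite 2!in_set (s1 x y xy) (s2 x y xy).
Qed.

(** Symmetric difference with [s] is an involution turning lifts for [tw] into lifts for [tw']. *)
Lemma card_lifts_shift (tw tw' : pred G) (phi : F -> G) s :
  is_lift (fun v => tw v (+) tw' v) phi s -> #|lifts tw phi| <= #|lifts tw' phi|.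
Proof.
move=> ls; pose h (t : {ffun F -> {set G}}) : {ffun F -> {set G}} :=
  [ffun x => symdiff (t x) (s x)].
have hK : involutive h by move=> t; apply/ffunP=> x; rewrite !ffunE symdiffK.
rewrite -(card_imset _ (inv_inj hK)); apply: subset_leq_card.
apply/subsetP=> _ /imsetP[t + ->]; rewrite !inE => lt; have := is_lift_add lt ls.
rewrite (_ : (fun v => _) = tw'); last by apply/funext=> v; rewrite addbA addbb.
by congr is_lift; apply/funext=> x; rewrite ffunE.
Qed.

Lemma card_lifts u (phi : F -> G) s : is_lift (pred1 u) phi s ->
  #|lifts (pred1 u) phi| = #|lifts pred0 phi|.
Proof.
move=> ls; apply/eqP; rewrite eqn_leq !(@card_lifts_shift _ _ _ s) //=.
by rewrite (_ : (fun v => _) = pred1 u) //; apply/funext=> v; rewrite addbF.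
Qed.

Lemma card_lifts_le u (phi : F -> G) : #|lifts (pred1 u) phi| <= #|lifts pred0 phi|.
Proof.
have [->|[s]] := set_0Vmem (lifts (pred1 u) phi); first by rewrite cards0.
by rewrite inE => /card_lifts->.
Qed.

End Count.

Lemma hom_cfi_twist (G : sgraph) (u : G) : hom G (cfi (pred1 u)) < hom G (cfi (@pred0 G)).
Proof.
rewrite !hom_cfi; pose i : {ffun G -> G} := [ffun x => x].
have iE : (i : G -> G) = id by apply/funext=> x; rewrite ffunE.
have hi : is_hom i by rewrite iE; apply/'forall_forallP=> x y; apply: implybb.
rewrite (bigD1 i) //= [X in _ < X](bigD1 i) //= -addSn.
apply: leq_add; last by apply: leq_sum => phi _; apply: card_lifts_le.
have -> : lifts (pred1 u) i = set0.
  by apply/setP=> s; rewrite !inE iE; apply/negbTE/id_not_lift.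
(* The constantly empty [sigma] lifts the identity to the untwisted graph. *)
rewrite cards0; apply/card_gt0P; exists [ffun=> set0]; rewrite inE.
apply/is_liftP; split=> [x w|x|x y _]; rewrite !ffunE ?inE //.
by rewrite cards0.
Qed.

Theorem theorem1p2 (k : nat) (k_ge1 : 1 <= k) :
  hom_distinguishing_closed (treewidth_at_most k).
Proof.
move=> F /haven_exists[r hr].
exists (cfi (pred1 (r set0))), (cfi (@pred0 F)); split.
  move=> F' twF'; rewrite !hom_cfi; apply: eq_bigr => phi _.
  by have [s ls] := haven_lift phi hr twF'; apply: card_lifts ls.
by apply/eqP; rewrite ltn_eqF // hom_cfi_twist.
Qed.
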